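(* Let $\alpha,\beta,\gamma\in\mathbb{C}$ satisfy $\frac{\alpha+1}{2},\frac{\beta+1}{2},\gamma+1,\frac{\alpha+\beta+1}{2}-\gamma\notin\mathbb{Z}_{\le0}$, i.e. $(\alpha,\beta,\gamma)$ lies in the domain of $H$. (1) If $(\alpha-2,\beta,\gamma)$ also lies in the domain of $H$, then $$\alpha(\alpha-2\gamma-1)H(\alpha,\beta;\gamma)-(\alpha-1)(\alpha+\beta-2\gamma-1)H(\alpha-2,\beta;\gamma)+1=0.$$ (2) If $(\alpha,\beta,\gamma-1)$ also lies in the domain of $H$, then $$2\gamma(2\gamma-\alpha-\beta-1)H(\alpha,\beta;\gamma)-(2\gamma-\alpha-1)(2\gamma-\beta-1)H(\alpha,\beta;\gamma-1)+1=0.$$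
   Context: For sequences $(a_n)_{n\ge0}$, $(b_n)_{n\ge1}$ of complex numbers, $\mathrm{CF}[a_n,b_n]$ denotes the continued fraction $a_0+\cfrac{b_1}{a_1+\cfrac{b_2}{a_2+\ddots}}$, whose value is $\lim_{n\to\infty}A_n/B_n$ (in $\mathbb{C}\cup\{\infty\}$), where $A_0=1$, $A_1=a_0$, $B_0=0$, $B_1=1$, and $A_{n+1}=a_nA_n+b_nA_{n-1}$, $B_{n+1}=a_nB_n+b_nB_{n-1}$ for $n\ge1$. With $\Delta f(n)=f(n+1)-f(n)$ (difference in $n$), define $$H(\alpha,\beta;\gamma)=\frac{1}{\mathrm{CF}\left[\Delta\bigl(n(n+\alpha)(n+\beta)\bigr),\,-2n(n+\alpha)(n+\beta)(n+\gamma)\right]}$$ (with $1/\infty=0$), i.e. $H=\lim_{n\to\infty}B_n/A_n$ for this continued fraction. The domain of $H$ is the set of $(\alpha,\beta,\gamma)\in\mathbb{C}^3$ with $\frac{\alpha+1}{2},\frac{\beta+1}{2},\gamma+1,\frac{\alpha+\beta+1}{2}-\gamma\notin\mathbb{Z}_{\le0}$. *)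

(* Defs.v *)
From Stdlib Require Import Reals.
From Coquelicot Require Import Coquelicot.

Open Scope R_scope.
Open Scope C_scope.

(** Numerators and denominators of the convergents of
    [a 0 + b 1 / (a 1 + b 2 / (a 2 + ...))], started at index [0] with the
    formal convergent [1/0]; the term [b 0] is never used. *)
Fixpoint CF_num (a b : nat -> C) (n : nat) : C :=
  match n with
  | O => 1
  | S m => match m with
           | O => a O
           | S l => a m * CF_num a b m + b m * CF_num a b l
           end
  end.

Fixpoint CF_den (a b : nat -> C) (n : nat) : C :=
  match n with
  | O => 0
  | S m => match m with
           | O => 1
           | S l => a m * CF_den a b m + b m * CF_den a b l
           end
  end.

Definition Delta (f : nat -> C) (n : nat) : C := f (S n) - f n.

Definition H_cubic (alpha beta : C) (n : nat) : C :=
  INR n * (INR n + alpha) * (INR n + beta).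

Definition H_a (alpha beta : C) : nat -> C := Delta (H_cubic alpha beta).

Definition H_b (alpha beta gamma : C) (n : nat) : C :=
  - (2) * INR n * (INR n + alpha) * (INR n + beta) * (INR n + gamma).

(** [h] is the (finite) limit of the reciprocals [B_n / A_n] of the convergents
    [A_n / B_n], so a continued fraction with value infinity gives [h = 0].
    Finitely many [A_n] may vanish; the first conjunct keeps the convention for
    division by zero from playing any role in the limit. *)
Definition is_H (alpha beta gamma h : C) : Prop :=
  let A := CF_num (H_a alpha beta) (H_b alpha beta gamma) in
  let B := CF_den (H_a alpha beta) (H_b alpha beta gamma) in
  eventually (fun n => A n <> 0) /\
  filterlim (fun n => B n / A n) eventually (locally h).

(** Total function; meaningful only at parameters where [is_H] has a (then
    unique) solution. *)
Definition H (alpha beta gamma : C) : C := iota (T := C_CompleteNormedModule) (is_H alpha beta gamma).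

Definition nonpos_integer (z : C) : Prop := exists k : nat, z = - INR k.

Definition H_domain (alpha beta gamma : C) : Prop :=
  ~ nonpos_integer ((alpha + 1) / 2) /\
  ~ nonpos_integer ((beta + 1) / 2) /\
  ~ nonpos_integer (gamma + 1) /\
  ~ nonpos_integer ((alpha + beta + 1) / 2 - gamma).

(* Main.v *)
Require Import Defs.
From Stdlib Require Import Reals.
From Coquelicot Require Import Coquelicot.
From Stdlib Require Import Lra Lia.

Open Scope R_scope.
Open Scope C_scope.

(** After division by [((n-1)!)^2] the recurrence for the numerators [A] and
    denominators [B] tends to [x_{n+1} = 3 x_n - 2 x_{n-1}], with roots [1] and
    [2].  If [A] follows the root [2], then [B / A] converges.

    Writing ['] for the parameters [(alpha - 2, beta, gamma)] and
    [Q_n = (n + alpha - 1) (n + 2 gamma + 2 - alpha)], one has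
      [A'_{n+1} - Q_n A'_n = (alpha - 1) (alpha + beta - 2 gamma - 1) A_n],
      [B'_{n+1} - Q_n B'_n = A_n + alpha (alpha - 2 gamma - 1) B_n].
    Since [Q_n ~ n^2] is about half of [A_{n+1} / A_n ~ 2 n^2], the recursions
    contract [n^2 A'_n / A_n] and [n^2 B'_n / A_n], which therefore tend to the limits of the right-hand sides
    divided by [A_n].  This gives (1), and transports dominance of [A] to [A'].
    For [alpha + M], [beta + M] with [M] large, dominance follows from a direct
    estimate, and one descends to the whole domain in steps of [2].

    For (2), with ['] now denoting [(alpha, beta, gamma - 1)],
    [c_n = n (n + alpha) (n + beta)] and [d = 2 gamma - alpha - beta - 1],
      [(d - n) A_n + c_n A_{n-1} = d A'_n],
      [2 gamma ((d - n) B_n + c_n B_{n-1})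
         = (2 gamma - alpha - 1) (2 gamma - beta - 1) B'_n - A'_n];
    divide by [n A_n]. *)

(** * Limits of complex sequences *)

(** Encoded through moduli so that squeeze, sum and ratio arguments for real sequences apply. *)
Definition Clim (u : nat -> C) (l : C) : Prop :=
  is_lim_seq (fun n => Cmod (u n - l)) 0.

Lemma is_lim_seq_0_le (u v : nat -> R) :
  eventually (fun n => 0 <= u n <= v n)%R -> is_lim_seq v 0 -> is_lim_seq u 0.
Proof.
  intros Huv Hv.
  apply (is_lim_seq_le_le_loc (fun _ => 0%R) u v); auto using is_lim_seq_const.
Qed.

Lemma Clim_le (u : nat -> C) (l : C) (v : nat -> R) :
  eventually (fun n => Cmod (u n - l) <= v n)%R -> is_lim_seq v 0 -> Clim u l.
Proof.
  intros Huv. apply is_lim_seq_0_le.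
  apply filter_imp with (2 := Huv). intros n Hn. split; [apply Cmod_ge_0 | exact Hn].
Qed.

Lemma Clim_lt (u : nat -> C) (l : C) (eps : R) :
  (0 < eps)%R -> Clim u l -> eventually (fun n => Cmod (u n - l) < eps)%R.
Proof.
  intros Heps Hu.
  apply is_lim_seq_spec in Hu.
  apply filter_imp with (2 := Hu (mkposreal eps Heps)).
  intros n. simpl. rewrite Rminus_0_r, Rabs_pos_eq by apply Cmod_ge_0. trivial.
Qed.

(** The balls of [C_UniformSpace] are squares and those of [Cmod] are discs; they are comparable up
    to the factor [sqrt 2], hence the radius [eps / sqrt 2] in the converse. *)
Lemma Clim_filterlim (u : nat -> C) (l : C) :
  Clim u l <-> filterlim u eventually (@locally C_UniformSpace l).
Proof.
  split.
  - intros Hu. apply filterlim_locally. intros eps.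
    apply filter_imp with (2 := Clim_lt u l eps (cond_pos eps) Hu).
    intros n Hn. apply C_NormedModule_mixin_compat1. exact Hn.
  - intros Hu. apply is_lim_seq_spec. intros eps.
    assert (Hpos : (0 < eps / sqrt 2)%R).
    { apply Rdiv_lt_0_compat; [apply cond_pos | apply Rlt_sqrt2_0]. }
    pose proof (proj1 (filterlim_locally (U := C_UniformSpace) u l) Hu) as Hball.
    apply filter_imp with (2 := Hball (mkposreal _ Hpos)).
    intros n Hn. apply C_NormedModule_mixin_compat2 in Hn. simpl in Hn.
    rewrite Rminus_0_r, Rabs_pos_eq by apply Cmod_ge_0.
    replace (pos eps) with (sqrt 2 * (eps / sqrt 2))%R.
    + exact Hn.
    + field. apply Rgt_not_eq, Rlt_sqrt2_0.
Qed.

Lemma Clim_unique (u : nat -> C) (l m : C) : Clim u l -> Clim u m -> l = m.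
Proof.
  intros Hl Hm.
  apply (@filterlim_locally_unique nat C_AbsRing C_NormedModule eventually _ u);
    apply Clim_filterlim; assumption.
Qed.

Lemma Clim_ext (u v : nat -> C) (l : C) :
  eventually (fun n => u n = v n) -> Clim u l -> Clim v l.
Proof.
  intros Huv Hu. apply Clim_le with (2 := Hu).
  apply filter_imp with (2 := Huv). intros n ->. apply Rle_refl.
Qed.

Lemma Clim_const (l : C) : Clim (fun _ => l) l.
Proof.
  apply Clim_le with (fun _ => 0%R); [| apply is_lim_seq_const].
  exists 0%nat. intros n _. replace (l - l) with (RtoC 0) by ring.
  rewrite Cmod_0. apply Rle_refl.
Qed.

Lemma Clim_succ (u : nat -> C) (l : C) : Clim u l <-> Clim (fun n => u (S n)) l.
Proof.
  unfold Clim. apply (is_lim_seq_incr_1 (fun n => Cmod (u n - l))).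
Qed.

Lemma Clim_plus (u v : nat -> C) (l m : C) :
  Clim u l -> Clim v m -> Clim (fun n => u n + v n) (l + m).
Proof.
  intros Hu Hv.
  apply Clim_le with (fun n => Cmod (u n - l) + Cmod (v n - m))%R.
  - exists 0%nat. intros n _.
    replace (u n + v n - (l + m)) with ((u n - l) + (v n - m)) by ring.
    apply Cmod_triangle.
  - replace (Finite 0) with (Finite (0 + 0)) by (f_equal; ring).
    apply is_lim_seq_plus'; assumption.
Qed.

Lemma Clim_mult (u v : nat -> C) (l m : C) :
  Clim u l -> Clim v m -> Clim (fun n => u n * v n) (l * m).
Proof.
  intros Hu Hv.
  apply Clim_le with (fun n => Cmod (u n - l) * Cmod (v n - m)
                        + (Cmod l * Cmod (v n - m) + Cmod (u n - l) * Cmod m))%R.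
  - exists 0%nat. intros n _.
    replace (u n * v n - l * m)
      with ((u n - l) * (v n - m) + (l * (v n - m) + (u n - l) * m)) by ring.
    rewrite <- !Cmod_mult.
    eapply Rle_trans; [apply Cmod_triangle | apply Rplus_le_compat_l, Cmod_triangle].
  - replace (Finite 0) with (Finite (0 * 0 + (Cmod l * 0 + 0 * Cmod m))) by (f_equal; ring).
    repeat apply is_lim_seq_plus'; apply is_lim_seq_mult';
      assumption || apply is_lim_seq_const.
Qed.

Lemma Clim_scal (c : C) (u : nat -> C) (l : C) :
  Clim u l -> Clim (fun n => c * u n) (c * l).
Proof. apply Clim_mult, Clim_const. Qed.

Lemma Clim_minus (u v : nat -> C) (l m : C) :
  Clim u l -> Clim v m -> Clim (fun n => u n - v n) (l - m).
Proof.
  intros Hu Hv. replace (l - m) with (l + (-1) * m) by ring.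
  apply Clim_ext with (fun n => u n + (-1) * v n).
  - exists 0%nat. intros n _. ring.
  - apply Clim_plus; [assumption | now apply Clim_scal].
Qed.

Lemma Clim_Cmod_gt (u : nat -> C) (l : C) (r : R) :
  (r < Cmod l)%R -> Clim u l -> eventually (fun n => r < Cmod (u n))%R.
Proof.
  intros Hr Hu.
  apply filter_imp with (2 := Clim_lt u l (Cmod l - r) ltac:(lra) Hu).
  intros n Hn.
  pose proof (Cmod_triangle (u n) (- (u n - l))) as Ht.
  rewrite Cmod_opp in Ht. replace (u n + - (u n - l)) with l in Ht by ring. lra.
Qed.

Lemma Clim_Cmod_lt (u : nat -> C) (l : C) (r : R) :
  (Cmod l < r)%R -> Clim u l -> eventually (fun n => Cmod (u n) < r)%R.
Proof.
  intros Hr Hu.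
  apply filter_imp with (2 := Clim_lt u l (r - Cmod l) ltac:(lra) Hu).
  intros n Hn.
  pose proof (Cmod_triangle (u n - l) l) as Ht.
  replace (u n - l + l) with (u n) in Ht by ring. lra.
Qed.

Lemma Clim_neq_0 (u : nat -> C) (l : C) :
  l <> 0 -> Clim u l -> eventually (fun n => u n <> 0).
Proof.
  intros Hl Hu.
  apply filter_imp with (2 := Clim_Cmod_gt u l 0 (proj1 (Cmod_gt_0 l) Hl) Hu).
  intros n. apply Cmod_gt_0.
Qed.

Lemma Clim_inv (u : nat -> C) (l : C) :
  l <> 0 -> Clim u l -> Clim (fun n => / u n) (/ l).
Proof.
  intros Hl Hu.
  pose proof (proj1 (Cmod_gt_0 l) Hl) as Hl0.
  apply Clim_le with (fun n => Cmod (u n - l) * (2 / (Cmod l * Cmod l)))%R.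
  - apply filter_imp with (2 := Clim_Cmod_gt u l (Cmod l / 2) ltac:(lra) Hu).
    intros n Hn.
    assert (Hun : u n <> 0) by (apply Cmod_gt_0; lra).
    replace (/ u n - / l) with (- (u n - l) * / (u n * l))
      by (field; split; assumption).
    rewrite Cmod_mult, Cmod_opp, Cmod_inv, Cmod_mult by (apply Cmult_neq_0; assumption).
    apply Rmult_le_compat_l; [apply Cmod_ge_0 |].
    replace (2 / (Cmod l * Cmod l))%R with (/ (Cmod l / 2 * Cmod l))%R by (field; lra).
    apply Rinv_le_contravar; nra.
  - replace (Finite 0) with (Finite (0 * (2 / (Cmod l * Cmod l)))) by (f_equal; ring).
    apply is_lim_seq_mult'; [exact Hu | apply is_lim_seq_const].
Qed.

Lemma Clim_div (u v : nat -> C) (l m : C) :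
  m <> 0 -> Clim u l -> Clim v m -> Clim (fun n => u n / v n) (l / m).
Proof.
  intros Hm Hu Hv. apply Clim_mult; [| apply Clim_inv]; assumption.
Qed.

Lemma Clim_inv_INR : Clim (fun n => / INR n) 0.
Proof.
  apply Clim_le with (fun n => / INR n)%R.
  - exists 1%nat. intros n Hn.
    assert (Hpos : (0 < INR n)%R) by (apply lt_0_INR; lia).
    replace (/ INR n - 0) with (/ INR n) by ring.
    rewrite <- RtoC_inv by lra.
    rewrite Cmod_R, Rabs_pos_eq by (apply Rlt_le, Rinv_0_lt_compat, Hpos).
    apply Rle_refl.
  - replace (Finite 0) with (Rbar_inv p_infty) by reflexivity.
    apply is_lim_seq_inv; [apply is_lim_seq_INR | discriminate].
Qed.

(** * Perturbed contractions *)

Lemma geometric_decay (x e : nat -> R) (q : R) :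
  (0 <= q < 1)%R -> (forall n, 0 <= x n)%R ->
  eventually (fun n => x (S n) <= q * x n + e n)%R ->
  is_lim_seq e 0 -> is_lim_seq x 0.
Proof.
  intros Hq Hx [N HN] He. apply is_lim_seq_spec in He.
  apply is_lim_seq_spec. intros eps. pose proof (cond_pos eps) as Heps.
  (* With errors below this threshold, [eps / 2] is the fixed point of
     [t => q * t + (1 - q) * (eps / 2)], which majorises the recursion. *)
  assert (Hd : (0 < (1 - q) * (eps / 2))%R) by (apply Rmult_lt_0_compat; lra).
  destruct (He (mkposreal _ Hd)) as [N' HN'].
  set (M := (N + N')%nat).
  assert (Hk : forall k, (x (k + M)%nat <= eps / 2 + q ^ k * x M)%R).
  { induction k as [|k IH].
    - simpl. lra.
    - pose proof (HN (k + M)%nat ltac:(lia)) as H1.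
      pose proof (HN' (k + M)%nat ltac:(lia)) as H2.
      rewrite Rminus_0_r in H2. simpl in H2. apply Rabs_lt_between in H2.
      simpl. pose proof (Rmult_le_compat_l q _ _ (proj1 Hq) IH). lra. }
  assert (Hg : is_lim_seq (fun k => q ^ k * x M)%R 0).
  { replace (Finite 0) with (Finite (0 * x M)) by (f_equal; ring).
    apply is_lim_seq_mult'; [| apply is_lim_seq_const].
    apply is_lim_seq_geom. rewrite Rabs_pos_eq; lra. }
  apply is_lim_seq_spec in Hg.
  destruct (Hg (mkposreal (eps / 2) ltac:(lra))) as [K HK].
  exists (K + M)%nat. intros n Hn.
  specialize (Hk (n - M)%nat). specialize (HK (n - M)%nat ltac:(lia)).
  replace (n - M + M)%nat with n in Hk by lia.
  rewrite Rminus_0_r in HK |- *. simpl in HK. apply Rabs_lt_between in HK.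
  rewrite Rabs_pos_eq by apply Hx. lra.
Qed.

(** The limiting map [t => t / 2 + l / 2] contracts towards its fixed point [l]; any rate strictly
    between 1/2 and 1 survives the perturbation of [f], and 3/4 is taken. *)
Lemma Clim_contraction (w f g : nat -> C) (l : C) :
  eventually (fun n => w (S n) = f n * w n + g n) ->
  Clim f (/ 2) -> Clim g (l / 2) -> Clim w l.
Proof.
  intros Hw Hf Hg.
  assert (He : Clim (fun n => f n * l + g n) l).
  { apply (eq_ind (/ 2 * l + l / 2) (Clim _)); [| field].
    apply Clim_plus; [apply Clim_mult; [exact Hf | apply Clim_const] | exact Hg]. }
  apply (geometric_decay _ (fun n => Cmod (f n * l + g n - l)) (3 / 4)); [lra | | | exact He].
  - intros n. apply Cmod_ge_0.
  - assert (Hhalf : (Cmod (/ 2) < 3 / 4)%R).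
    { rewrite <- RtoC_inv, Cmod_R, Rabs_pos_eq; lra. }
    generalize (filter_and _ _ Hw (Clim_Cmod_lt f _ _ Hhalf Hf)).
    apply filter_imp. intros n [-> Hn].
    replace (f n * w n + g n - l) with (f n * (w n - l) + (f n * l + g n - l)) by ring.
    eapply Rle_trans; [apply Cmod_triangle |].
    apply Rplus_le_compat_r. rewrite Cmod_mult.
    apply Rmult_le_compat_r; [apply Cmod_ge_0 | lra].
Qed.

(** * Contiguous recurrences *)

Definition satisfies_rec (a b u : nat -> C) : Prop :=
  forall n, u (S (S n)) = a (S n) * u (S n) + b (S n) * u n.

(** Reduces each contiguous identity to the indices 0 and 1, once both sides are known to solve the
    same recurrence. *)
Lemma satisfies_rec_unique (a b u v : nat -> C) :
  satisfies_rec a b u -> satisfies_rec a b v ->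
  u 0%nat = v 0%nat -> u 1%nat = v 1%nat -> forall n, u n = v n.
Proof.
  intros Hu Hv H0 H1 n.
  enough (u n = v n /\ u (S n) = v (S n)) by tauto.
  induction n as [|n [IH0 IH1]]; [tauto |].
  split; [exact IH1 |]. now rewrite Hu, Hv, IH0, IH1.
Qed.

Lemma satisfies_rec_lin (a b u v : nat -> C) (x y : C) :
  satisfies_rec a b u -> satisfies_rec a b v ->
  satisfies_rec a b (fun n => x * u n + y * v n).
Proof. intros Hu Hv n. rewrite Hu, Hv. ring. Qed.

Lemma satisfies_rec_scal (a b u : nat -> C) (x : C) :
  satisfies_rec a b u -> satisfies_rec a b (fun n => x * u n).
Proof. intros Hu n. rewrite Hu. ring. Qed.

Lemma satisfies_rec_succ (a b u : nat -> C) :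
  satisfies_rec a b u ->
  satisfies_rec (fun n => a (S n)) (fun n => b (S n)) (fun n => u (S n)).
Proof. intros Hu n. apply Hu. Qed.

Definition num (alpha beta gamma : C) : nat -> C :=
  CF_num (H_a alpha beta) (H_b alpha beta gamma).

Definition den (alpha beta gamma : C) : nat -> C :=
  CF_den (H_a alpha beta) (H_b alpha beta gamma).

Lemma num_rec (alpha beta gamma : C) :
  satisfies_rec (H_a alpha beta) (H_b alpha beta gamma) (num alpha beta gamma).
Proof. intros n. reflexivity. Qed.

Lemma den_rec (alpha beta gamma : C) :
  satisfies_rec (H_a alpha beta) (H_b alpha beta gamma) (den alpha beta gamma).
Proof. intros n. reflexivity. Qed.

Lemma INR_S (n : nat) : RtoC (INR (S n)) = INR n + 1.
Proof. now rewrite S_INR, RtoC_plus. Qed.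

Ltac expand_coeffs :=
  unfold num, den; cbn [CF_num CF_den];
  unfold H_a, H_b, Defs.Delta, H_cubic; rewrite ?INR_S; change (INR 0) with 0%R.

Definition alpha_coeff (alpha gamma : C) (n : nat) : C :=
  (INR n + alpha - 1) * (INR n + 2 * gamma + 2 - alpha).

(* [H_b alpha beta gamma n * alpha_coeff alpha gamma (n - 1)] is a multiple of
   [H_b (alpha - 2) beta gamma n], so no division by a possibly vanishing
   partial numerator is needed. *)
Lemma alpha_shift_rec (alpha beta gamma : C) (u : nat -> C) :
  satisfies_rec (H_a (alpha - 2) beta) (H_b (alpha - 2) beta gamma) u ->
  satisfies_rec (H_a alpha beta) (H_b alpha beta gamma)
    (fun n => u (S n) - alpha_coeff alpha gamma n * u n).
Proof.
  intros Hu n.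
  pose proof (Hu n) as H0. pose proof (Hu (S n)) as H1.
  assert (Hb : H_b alpha beta gamma (S n) * (alpha_coeff alpha gamma n * u n)
    = (INR (S n) + alpha) * (INR (S n) + 1 + 2 * gamma - alpha)
      * (u (S (S n)) - H_a (alpha - 2) beta (S n) * u (S n))).
  { rewrite H0. unfold alpha_coeff. expand_coeffs. ring. }
  replace (H_b alpha beta gamma (S n) * (u (S n) - alpha_coeff alpha gamma n * u n))
    with (H_b alpha beta gamma (S n) * u (S n)
          - H_b alpha beta gamma (S n) * (alpha_coeff alpha gamma n * u n)) by ring.
  rewrite Hb, H1. unfold alpha_coeff. expand_coeffs. ring.
Qed.

Lemma alpha_shift_num (alpha beta gamma : C) (n : nat) :
  num (alpha - 2) beta gamma (S n)
    - alpha_coeff alpha gamma n * num (alpha - 2) beta gamma n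
  = (alpha - 1) * (alpha + beta - 2 * gamma - 1) * num alpha beta gamma n.
Proof.
  pose proof (satisfies_rec_scal _ _ _
    ((alpha - 1) * (alpha + beta - 2 * gamma - 1)) (num_rec alpha beta gamma)) as Hr.
  rewrite (satisfies_rec_unique _ _ _ _
    (alpha_shift_rec alpha beta gamma _ (num_rec (alpha - 2) beta gamma)) Hr).
  - ring.
  - unfold alpha_coeff. expand_coeffs. ring.
  - unfold alpha_coeff. expand_coeffs. ring.
Qed.

Lemma alpha_shift_den (alpha beta gamma : C) (n : nat) :
  den (alpha - 2) beta gamma (S n)
    - alpha_coeff alpha gamma n * den (alpha - 2) beta gamma n
  = num alpha beta gamma n + alpha * (alpha - 2 * gamma - 1) * den alpha beta gamma n.
Proof.
  pose proof (satisfies_rec_lin _ _ _ _ 1 (alpha * (alpha - 2 * gamma - 1))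
    (num_rec alpha beta gamma) (den_rec alpha beta gamma)) as Hr.
  rewrite (satisfies_rec_unique _ _ _ _
    (alpha_shift_rec alpha beta gamma _ (den_rec (alpha - 2) beta gamma)) Hr).
  - ring.
  - unfold alpha_coeff. expand_coeffs. ring.
  - unfold alpha_coeff. expand_coeffs. ring.
Qed.

(** The combination [(d - m) u_m + c_m u_{m-1}] at [m = n + 1], which avoids a predecessor; its
    identities therefore involve the sequences for [gamma - 1] at [S n]. *)
Definition gamma_shift (alpha beta gamma : C) (u : nat -> C) (n : nat) : C :=
  (2 * gamma - alpha - beta - 1 - INR (S n)) * u (S n) + H_cubic alpha beta (S n) * u n.

Lemma gamma_shift_rec (alpha beta gamma : C) (u : nat -> C) :
  satisfies_rec (H_a alpha beta) (H_b alpha beta gamma) u ->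
  satisfies_rec (fun n => H_a alpha beta (S n)) (fun n => H_b alpha beta (gamma - 1) (S n))
    (gamma_shift alpha beta gamma u).
Proof.
  intros Hu n.
  pose proof (Hu n) as H0. pose proof (Hu (S n)) as H1.
  (* Since [(n + 2) + (gamma - 1) = (n + 1) + gamma], this product of coefficients equals [H_cubic
     (S (S n)) * H_b alpha beta gamma (S n)], and the recurrence for [u] eliminates [u n]. *)
  assert (Hb : H_b alpha beta (gamma - 1) (S (S n)) * (H_cubic alpha beta (S n) * u n)
    = H_cubic alpha beta (S (S n)) * (u (S (S n)) - H_a alpha beta (S n) * u (S n))).
  { rewrite H0. expand_coeffs. ring. }
  unfold gamma_shift. cbv beta.
  rewrite (Cmult_plus_distr_l (H_b _ _ _ _)), Hb, H1.
  expand_coeffs. ring.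
Qed.

Lemma gamma_shift_num (alpha beta gamma : C) (n : nat) :
  gamma_shift alpha beta gamma (num alpha beta gamma) n
  = (2 * gamma - alpha - beta - 1) * num alpha beta (gamma - 1) (S n).
Proof.
  pose proof (satisfies_rec_succ _ _ _ (num_rec alpha beta (gamma - 1))) as Hs.
  pose proof (satisfies_rec_scal _ _ _ (2 * gamma - alpha - beta - 1) Hs) as Hr.
  rewrite (satisfies_rec_unique _ _ _ _
    (gamma_shift_rec alpha beta gamma _ (num_rec alpha beta gamma)) Hr).
  - ring.
  - unfold gamma_shift. expand_coeffs. ring.
  - unfold gamma_shift. expand_coeffs. ring.
Qed.

(** The shifted denominators are a combination of the two basic solutions for [gamma - 1]; the
    factor [2 * gamma] on the left keeps the coefficients polynomial. *)
Lemma gamma_shift_den (alpha beta gamma : C) (n : nat) :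
  2 * gamma * gamma_shift alpha beta gamma (den alpha beta gamma) n
  = (2 * gamma - alpha - 1) * (2 * gamma - beta - 1) * den alpha beta (gamma - 1) (S n)
    - num alpha beta (gamma - 1) (S n).
Proof.
  pose proof (gamma_shift_rec alpha beta gamma _ (den_rec alpha beta gamma)) as Hg.
  pose proof (satisfies_rec_scal _ _ _ (2 * gamma) Hg) as Hl.
  pose proof (satisfies_rec_lin _ _ _ _
    ((2 * gamma - alpha - 1) * (2 * gamma - beta - 1)) (-1)
    (satisfies_rec_succ _ _ _ (den_rec alpha beta (gamma - 1)))
    (satisfies_rec_succ _ _ _ (num_rec alpha beta (gamma - 1)))) as Hr.
  pose proof (satisfies_rec_unique _ _ _ _ Hl Hr) as He. cbv beta in He.
  rewrite He.
  - ring.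
  - unfold gamma_shift. expand_coeffs. ring.
  - unfold gamma_shift. expand_coeffs. ring.
Qed.

(** * Dominant solutions *)

Lemma INR_neq_0 (n : nat) : (0 < n)%nat -> RtoC (INR n) <> 0.
Proof.
  intros Hn He. apply RtoC_inj in He. apply lt_0_INR in Hn. lra.
Qed.

Lemma eventually_INR_neq_0 : eventually (fun n => RtoC (INR n) <> 0).
Proof. exists 1%nat. intros n Hn. apply INR_neq_0. lia. Qed.

Lemma Clim_INR_plus_div (z : C) : Clim (fun n => (INR n + z) / INR n) 1.
Proof.
  apply (eq_ind (1 + z * 0) (Clim _)); [| ring].
  apply Clim_ext with (fun n => 1 + z * / INR n).
  - apply filter_imp with (2 := eventually_INR_neq_0). intros n Hn. now field.
  - apply Clim_plus; [apply Clim_const | apply Clim_scal, Clim_inv_INR].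
Qed.

Lemma Clim_INR_S_div : Clim (fun n => INR (S n) / INR n) 1.
Proof.
  apply Clim_ext with (2 := Clim_INR_plus_div 1).
  exists 0%nat. intros n _. now rewrite INR_S.
Qed.

(** * Asymptotics of the coefficients *)

Lemma H_a_lim (alpha beta : C) :
  Clim (fun n => H_a alpha beta n / (INR n * INR n)) 3.
Proof.
  apply (eq_ind (3 + (3 + 2 * (alpha + beta)) * 0
    + (1 + alpha) * (1 + beta) * (0 * 0)) (Clim _)); [| ring].
  apply Clim_ext with (fun n => 3 + (3 + 2 * (alpha + beta)) * / INR n
    + (1 + alpha) * (1 + beta) * (/ INR n * / INR n)).
  - apply filter_imp with (2 := eventually_INR_neq_0). intros n Hn.
    expand_coeffs. now field.
  - apply Clim_plus; [apply Clim_plus; [apply Clim_const |] |]; apply Clim_scal.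
    + apply Clim_inv_INR.
    + apply Clim_mult; apply Clim_inv_INR.
Qed.

(** The normalisation fits [z_n = u_{n+1} / (n^2 u_n)]: dividing the recurrence by [(n+1)^2 u_{n+1}]
    leaves exactly this quotient in front of [1 / z_n]. *)
Lemma H_b_lim (alpha beta gamma : C) :
  Clim (fun n => H_b alpha beta gamma (S n) / (INR (S n) * INR (S n) * (INR n * INR n))) (-2).
Proof.
  apply (eq_ind (-2 * (1 * 1) * (1 * 1)) (Clim _)); [| ring].
  apply Clim_ext with (fun n =>
    -2 * (((INR (S n) + alpha) / INR (S n)) * ((INR n + (1 + beta)) / INR n))
       * (1 * ((INR n + (1 + gamma)) / INR n))).
  - exists 1%nat. intros n Hn.
    pose proof (INR_neq_0 n ltac:(lia)). pose proof (INR_neq_0 (S n) ltac:(lia)) as HS.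
    rewrite INR_S in HS. expand_coeffs. field. split; assumption.
  - repeat apply Clim_mult; try apply Clim_const; try apply Clim_INR_plus_div.
    apply (Clim_succ (fun n => (INR n + alpha) / INR n)), Clim_INR_plus_div.
Qed.

Lemma alpha_coeff_lim (alpha gamma : C) :
  Clim (fun n => alpha_coeff alpha gamma n / (INR n * INR n)) 1.
Proof.
  apply (eq_ind (1 * 1) (Clim _)); [| ring].
  apply Clim_ext with (fun n =>
    ((INR n + (alpha - 1)) / INR n) * ((INR n + (2 * gamma + 2 - alpha)) / INR n)).
  - apply filter_imp with (2 := eventually_INR_neq_0). intros n Hn.
    unfold alpha_coeff. now field.
  - apply Clim_mult; apply Clim_INR_plus_div.
Qed.

(* The characteristic equation [x^2 = 3 x - 2] of the recurrence has roots [1]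
   and [2]; a dominant solution is one following the root [2]. *)
Definition dominant (u : nat -> C) : Prop :=
  eventually (fun n => u n <> 0) /\
  Clim (fun n => u (S n) / (INR n * INR n * u n)) 2.

Lemma C2_neq_0 : RtoC 2 <> 0.
Proof. intros He. apply RtoC_inj in He. lra. Qed.

Lemma dominant_ext (u v : nat -> C) : (forall n, u n = v n) -> dominant u -> dominant v.
Proof.
  intros Huv [H0 H1]. split.
  - apply filter_imp with (2 := H0). intros n. now rewrite Huv.
  - apply Clim_ext with (2 := H1). exists 0%nat. intros n _. now rewrite !Huv.
Qed.

Lemma eventually_S (P : nat -> Prop) : eventually P -> eventually (fun n => P (S n)).
Proof. intros [N HN]. exists N. intros n Hn. apply HN. lia. Qed.

(** For [w_n = n^2 X_n / A_n] the recursion becomes [w_{n+1} = f_n w_n + g_n]. As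
    [A_{n+1} / (n^2 A_n)] tends to 2, [f_n] tends to 1/2 and [g_n] to [l / 2]. *)
Lemma dominant_forcing (A X Y q : nat -> C) (l : C) :
  dominant A ->
  Clim (fun n => q n / (INR n * INR n)) 1 ->
  (forall n, X (S n) - q n * X n = Y n) ->
  Clim (fun n => Y n / A n) l ->
  Clim (fun n => INR n * INR n * X n / A n) l.
Proof.
  intros [HA Hz] Hq HX HY.
  apply Clim_contraction with
    (fun n => (INR (S n) / INR n) * (INR (S n) / INR n) * (q n / (INR n * INR n))
              / (A (S n) / (INR n * INR n * A n)))
    (fun n => (INR (S n) / INR n) * (INR (S n) / INR n) * (Y n / A n)
              / (A (S n) / (INR n * INR n * A n))).
  - generalize (filter_and _ _ eventually_INR_neq_0
      (filter_and _ _ HA (eventually_S _ HA))).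
    apply filter_imp. intros n (Hn & HAn & HAS).
    rewrite <- HX. field. tauto.
  - apply (eq_ind (1 * 1 * 1 / 2) (Clim _)); [| field].
    apply Clim_div; [apply C2_neq_0 | | exact Hz].
    repeat apply Clim_mult; try apply Clim_INR_S_div. exact Hq.
  - apply (eq_ind (1 * 1 * l / 2) (Clim _)); [| field].
    apply Clim_div; [apply C2_neq_0 | | exact Hz].
    repeat apply Clim_mult; try apply Clim_INR_S_div. exact HY.
Qed.

(** [X_n] behaves like [l A_n / n^2], and the factor [n^2] does not affect the limit of ratios of
    consecutive terms. *)
Lemma dominant_of_asymp (A X : nat -> C) (l : C) :
  l <> 0 -> dominant A -> Clim (fun n => INR n * INR n * X n / A n) l -> dominant X.
Proof.
  intros Hl [HA Hz] Hw. pose proof (Clim_neq_0 _ _ Hl Hw) as Hw0.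
  assert (HX : eventually (fun n => X n <> 0)).
  { apply filter_imp with (2 := Hw0). intros n Hn HX. apply Hn.
    rewrite HX. unfold Cdiv. ring. }
  split; [exact HX |].
  apply (eq_ind (2 * (l / l) / (1 * 1)) (Clim _)).
  2: { field. exact Hl. }
  apply Clim_ext with (fun n => A (S n) / (INR n * INR n * A n)
    * ((INR (S n) * INR (S n) * X (S n) / A (S n)) / (INR n * INR n * X n / A n))
    / ((INR (S n) / INR n) * (INR (S n) / INR n))).
  - generalize (filter_and _ _ eventually_INR_neq_0
      (filter_and _ _ HA (filter_and _ _ (eventually_S _ HA) HX))).
    apply filter_imp. intros n (Hn & HAn & HAS & HXn).
    field. repeat split; trivial. now apply INR_neq_0; lia.
  - apply Clim_div.
    + intros He. rewrite <- RtoC_mult in He. apply RtoC_inj in He. lra.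
    + apply Clim_mult; [exact Hz |]. apply Clim_div; [exact Hl | | exact Hw].
      apply (Clim_succ (fun n => INR n * INR n * X n / A n)), Hw.
    + apply Clim_mult; apply Clim_INR_S_div.
Qed.

Lemma ratio_test_Clim (u f : nat -> C) :
  eventually (fun n => u (S (S n)) - u (S n) = f n * (u (S n) - u n)) ->
  Clim f (/ 2) -> exists l, Clim u l.
Proof.
  intros Hu Hf.
  assert (Hhalf : (Cmod (/ 2) < 3 / 4)%R).
  { rewrite <- RtoC_inv, Cmod_R, Rabs_pos_eq; lra. }
  destruct (filter_and _ _ Hu (Clim_Cmod_lt f _ _ Hhalf Hf)) as [N HN].
  set (d := fun n => u (S (n + N)%nat) - u (n + N)%nat).
  assert (Hd : forall n, (Cmod (d n) <= Cmod (d 0%nat) * (3 / 4) ^ n)%R).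
  { induction n as [|n IH]; [simpl; lra |].
    destruct (HN (n + N)%nat ltac:(lia)) as [He Hlt].
    change (d (S n)) with (u (S (S (n + N))) - u (S (n + N))).
    rewrite He, Cmod_mult. fold (d n).
    simpl pow. pose proof (Cmod_ge_0 (d n)). pose proof (Cmod_ge_0 (f (n + N)%nat)). nra. }
  assert (Hs : ex_series (V := C_CompleteNormedModule) d).
  { apply (@ex_series_le C_AbsRing C_CompleteNormedModule) with (1 := Hd).
    apply (ex_series_scal_l (V := R_NormedModule)). apply ex_series_geom.
    rewrite Rabs_pos_eq; lra. }
  destruct Hs as [l Hl].
  exists (l + u N).
  (* Telescoping from index [N]; [sum_n] includes the term of index [n], hence [n + S N]. *)
  assert (Hsum : forall n,
    @eq C (sum_n (G := C_CompleteNormedModule) d n) (u (n + S N)%nat - u N)).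
  { induction n as [|n IH].
    - rewrite sum_O. reflexivity.
    - rewrite sum_Sn, IH. unfold d. change plus with Cplus.
      replace (S n + N)%nat with (n + S N)%nat by lia.
      replace (S n + S N)%nat with (S (n + S N)) by lia. ring. }
  assert (HC : Clim (fun n => u (n + S N)%nat) (l + u N)).
  { apply Clim_ext with (fun n => sum_n (G := C_CompleteNormedModule) d n + u N).
    - exists 0%nat. intros n _. rewrite Hsum. ring.
    - apply Clim_plus; [| apply Clim_const]. apply Clim_filterlim. exact Hl. }
  unfold Clim in HC |- *.
  apply (is_lim_seq_incr_n (fun n => Cmod (u n - (l + u N))) (S N)). exact HC.
Qed.

(* [v / u] converges because the differences of consecutive terms have
   Casoratian numerators, hence ratios tending to [2 / 2^2]. *)
Lemma dominant_quotient_cv (alpha beta gamma : C) (u v : nat -> C) :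
  satisfies_rec (H_a alpha beta) (H_b alpha beta gamma) u ->
  satisfies_rec (H_a alpha beta) (H_b alpha beta gamma) v ->
  dominant u -> exists h, Clim (fun n => v n / u n) h.
Proof.
  intros Hu Hv [Hu0 Hz].
  apply ratio_test_Clim with (fun n =>
    -1 * (H_b alpha beta gamma (S n) / (INR (S n) * INR (S n) * (INR n * INR n)))
    / ((u (S n) / (INR n * INR n * u n))
       * (u (S (S n)) / (INR (S n) * INR (S n) * u (S n))))).
  - generalize (filter_and _ _ eventually_INR_neq_0 (filter_and _ _ Hu0
      (filter_and _ _ (eventually_S _ Hu0) (eventually_S _ (eventually_S _ Hu0))))).
    apply filter_imp. intros n (Hn & H0 & H1 & H2).
    rewrite (Hv n). rewrite (Hu n) in H2 |- *.
    field. repeat split; trivial. now apply INR_neq_0; lia.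
  - apply (eq_ind (-1 * -2 / (2 * 2)) (Clim _)); [| field].
    apply Clim_div.
    + apply Cmult_neq_0; apply C2_neq_0.
    + apply Clim_scal, H_b_lim.
    + apply Clim_mult; [exact Hz |].
      apply (Clim_succ (fun n => u (S n) / (INR n * INR n * u n))), Hz.
Qed.

(** The ratios satisfy [z_{n+1} = p_n + q_n / z_n] with [p_n -> 3] and [q_n -> -2]. The growth
    hypothesis gives [|z_n| >= 3/2], which separates them from the root 1. *)
Lemma dominant_of_growth (alpha beta gamma : C) (u : nat -> C) :
  satisfies_rec (H_a alpha beta) (H_b alpha beta gamma) u ->
  eventually (fun n => u n <> 0) ->
  eventually (fun n => 3 / 2 * (INR n * INR n) * Cmod (u n) <= Cmod (u (S n)))%R ->
  dominant u.
Proof.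
  intros Hu Hu0 Hgrow. split; [exact Hu0 |].
  set (p := fun n => H_a alpha beta (S n) / (INR (S n) * INR (S n))).
  set (q := fun n => H_b alpha beta gamma (S n) / (INR (S n) * INR (S n) * (INR n * INR n))).
  set (z := fun n => u (S n) / (INR n * INR n * u n)).
  apply (geometric_decay _ (fun n => Cmod (p n - 3) + Cmod (q n - - (2)))%R (2 / 3)).
  - lra.
  - intros n. apply Cmod_ge_0.
  - generalize (filter_and _ _ Hgrow (filter_and _ _ eventually_INR_neq_0
      (filter_and _ _ Hu0 (eventually_S _ Hu0)))).
    apply filter_imp. intros n (Hg & Hn & H0 & H1).
    assert (Hz : (3 / 2 <= Cmod (z n))%R).
    { unfold z. rewrite Cmod_div, Cmod_mult by (repeat apply Cmult_neq_0; trivial).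
      assert (Hpos : (0 < Cmod (INR n * INR n) * Cmod (u n))%R)
        by (apply Rmult_lt_0_compat; apply Cmod_gt_0; [now apply Cmult_neq_0 | trivial]).
      apply Rmult_le_reg_r with (1 := Hpos).
      unfold Rdiv at 2. rewrite Rmult_assoc, Rinv_l, Rmult_1_r by lra.
      rewrite <- RtoC_mult, Cmod_R, Rabs_pos_eq by (pose proof (pos_INR n); nra). lra. }
    assert (Hz0 : z n <> 0) by (apply Cmod_gt_0; lra).
    (* Because [3 - 2 / z - 2 = (z - 2) / z], the distance to 2 contracts by [1 / |z| <= 2/3], up to
       the errors of [p] and [q]. *)
    assert (HzS : z (S n) - 2 = (p n - 3) + (q n - - (2)) * / z n + (z n - 2) * / z n).
    { unfold z, p, q in *. rewrite (Hu n). field.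
      repeat split; trivial. now apply INR_neq_0; lia. }
    change (Cmod (z (S n) - 2) <= 2 / 3 * Cmod (z n - 2) + (Cmod (p n - 3) + Cmod (q n - - (2))))%R.
    rewrite HzS.
    assert (Hi : (0 <= Cmod (/ z n) <= 2 / 3)%R).
    { split; [apply Cmod_ge_0 |]. rewrite Cmod_inv by trivial.
      replace (2 / 3)%R with (/ (3 / 2))%R by field. apply Rinv_le_contravar; lra. }
    pose proof (Cmod_triangle ((p n - 3) + (q n - - (2)) * / z n) ((z n - 2) * / z n)).
    pose proof (Cmod_triangle (p n - 3) ((q n - - (2)) * / z n)).
    rewrite !Cmod_mult in *.
    pose proof (Cmod_ge_0 (q n - - (2))). pose proof (Cmod_ge_0 (z n - 2)). nra.
  - replace (Finite 0) with (Finite (0 + 0)) by (f_equal; ring).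
    apply is_lim_seq_plus'.
    + apply (Clim_succ (fun n => H_a alpha beta n / (INR n * INR n))), H_a_lim.
    + pose proof (H_b_lim alpha beta gamma) as Hb. unfold Clim in Hb.
      apply is_lim_seq_ext with (2 := Hb). intros n. unfold q. f_equal. f_equal. f_equal.
      now rewrite <- RtoC_opp.
Qed.

(** * Dominance for large parameters *)

(** With [y = n + M] and [t = 3 n + M] the main terms are [2 n^2 y^2] and [(y t / 2)^2], so the core
    is [8 n^2 <= t^2]. The gap between 8 and 9 absorbs the errors of one per cent caused by [K], [L]
    and the index shift. *)
Lemma growth_inequality (n M K L : R) :
  (1 <= n -> 0 <= K -> 0 <= L -> 300 <= M -> 100 * K <= M -> 200 * L <= M ->
  2 * n * (n + K) * ((n + M + K) * (n + M + K))
  <= ((n + M) * (3 * n + M) / 2 - L * (n + M)) * ((n - 1 + M) * (3 * (n - 1) + M) / 2))%R.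
Proof.
  intros Hn HK HL H3 HMK HML.
  set (y := (n + M)%R). set (t := (3 * n + M)%R).
  assert (Hy : (301 <= y)%R) by (unfold y; lra).
  assert (Ht : (303 <= t)%R) by (unfold t; lra).
  assert (Hlow : (99 / 100 * (y * t) / 2 * (99 / 100 * y * (99 / 100 * t) / 2)
    <= (y * t / 2 - L * y) * ((n - 1 + M) * (3 * (n - 1) + M) / 2))%R).
  { apply Rmult_le_compat.
    - apply Rmult_le_pos; nra.
    - apply Rmult_le_pos; nra.
    - assert (HLt : (200 * L <= t)%R) by (unfold t; lra). nra.
    - apply Rmult_le_compat_r; [lra |].
      apply Rmult_le_compat; unfold y, t in *; lra. }
  eapply Rle_trans; [| exact Hlow].
  assert (Hup : (2 * n * (n + K) * ((y + K) * (y + K))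
    <= 2 * n * (n + y / 100) * (101 / 100 * y * (101 / 100 * y)))%R).
  { assert (HKy : (K <= y / 100)%R) by (unfold y; lra).
    apply Rmult_le_compat.
    - apply Rmult_le_pos; lra.
    - apply Rmult_le_pos; lra.
    - apply Rmult_le_compat_l; lra.
    - apply Rmult_le_compat; lra. }
  eapply Rle_trans; [exact Hup |].
  (* Here [102/100 * 101/100] exceeds [(101/100)^2], and [97/100] lies below [(99/100)^3], the
     accumulated losses on the two sides. *)
  assert (Hnt : (8 * (102 / 100) * 101 / 100 * (n * (n + y / 100)) <= 97 / 100 * (t * t))%R).
  { assert (0 <= n * M)%R by nra. unfold y, t. nra. }
  assert (Hyy : (0 <= y * y)%R) by nra.
  pose proof (Rmult_le_compat_l _ _ _ Hyy Hnt) as Hf.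
  assert (0 <= (y * y) * (t * t))%R by (apply Rmult_le_pos; nra).
  assert (0 <= (y * y) * (n * (n + y / 100)))%R by (apply Rmult_le_pos; nra).
  nra.
Qed.

(** The remainder splits into three terms bounded by [4 y], [6 K y] and [K^2], where [y = n + M];
    [11 = 4 + 6 + 1] because [K] and [y] are at least 1. *)
Lemma H_a_bound (alpha beta : C) (M K : R) (n : nat) :
  (1 <= M -> 1 <= K -> Cmod alpha <= K -> Cmod beta <= K ->
  Cmod (H_a (M + alpha) (M + beta) n - ((INR n + M) * (3 * INR n + M))%R)
  <= 11 * (K * K) * (INR n + M))%R.
Proof.
  intros HM HK Ha Hb. pose proof (pos_INR n) as Hn. set (y := (INR n + M)%R).
  replace (H_a (M + alpha) (M + beta) n - RtoC (y * (3 * INR n + M)))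
    with (RtoC (3 * INR n + 1 + 2 * M) + (RtoC (2 * INR n + 1 + M) * (alpha + beta) + alpha * beta)).
  2: { unfold y. expand_coeffs. rewrite !RtoC_plus, !RtoC_mult, !RtoC_plus, !RtoC_mult. ring. }
  assert (H1 : (Cmod (RtoC (3 * INR n + 1 + 2 * M)) <= 4 * y)%R).
  { rewrite Cmod_R, Rabs_pos_eq by lra. unfold y. lra. }
  assert (H2 : (Cmod (RtoC (2 * INR n + 1 + M) * (alpha + beta)) <= 3 * y * (2 * K))%R).
  { rewrite Cmod_mult, Cmod_R, Rabs_pos_eq by lra.
    apply Rmult_le_compat; [lra | apply Cmod_ge_0 | unfold y; lra |].
    pose proof (Cmod_triangle alpha beta). lra. }
  assert (H3 : (Cmod (alpha * beta) <= K * K)%R).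
  { rewrite Cmod_mult. apply Rmult_le_compat; auto using Cmod_ge_0. }
  pose proof (Cmod_triangle (RtoC (3 * INR n + 1 + 2 * M))
    (RtoC (2 * INR n + 1 + M) * (alpha + beta) + alpha * beta)).
  pose proof (Cmod_triangle (RtoC (2 * INR n + 1 + M) * (alpha + beta)) (alpha * beta)).
  assert (Hy : (1 <= y)%R) by (unfold y; lra).
  assert (y <= K * y)%R by nra. assert (K * y <= K * K * y)%R by nra.
  assert (K * K <= K * K * y)%R by nra. nra.
Qed.

Lemma Cmod_INR_plus_le (n : nat) (M K : R) (z : C) :
  (0 <= M -> Cmod z <= K -> Cmod (INR n + (M + z)) <= INR n + M + K)%R.
Proof.
  intros HM Hz. pose proof (pos_INR n).
  pose proof (Cmod_triangle (RtoC (INR n + M)) z) as Ht.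
  rewrite Cmod_R, Rabs_pos_eq in Ht by lra.
  replace (INR n + (M + z)) with (RtoC (INR n + M) + z) by (rewrite RtoC_plus; ring). lra.
Qed.

Lemma H_b_bound (alpha beta gamma : C) (M K : R) (n : nat) :
  (0 <= M -> Cmod alpha <= K -> Cmod beta <= K -> Cmod gamma <= K ->
  Cmod (H_b (M + alpha) (M + beta) gamma n)
  <= 2 * INR n * (INR n + K) * ((INR n + M + K) * (INR n + M + K)))%R.
Proof.
  intros HM Ha Hb Hc. pose proof (pos_INR n) as Hn.
  pose proof (Cmod_INR_plus_le n M K alpha HM Ha) as H1.
  pose proof (Cmod_INR_plus_le n M K beta HM Hb) as H2.
  pose proof (Cmod_INR_plus_le n 0 K gamma (Rle_refl 0) Hc) as H3.
  rewrite Cplus_0_l, Rplus_0_r in H3.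
  unfold H_b. rewrite !Cmod_mult, Cmod_opp, !Cmod_R, !Rabs_pos_eq by lra.
  replace (2 * INR n * (INR n + K) * ((INR n + M + K) * (INR n + M + K)))%R
    with (2 * INR n * (INR n + M + K) * (INR n + M + K) * (INR n + K))%R by ring.
  repeat apply Rmult_le_compat; repeat apply Rmult_le_pos; auto using Cmod_ge_0; lra.
Qed.

(* Up to relative errors [O(K^2 / M)] the coefficients are
   [(n + M) (3 n + M)] and [-2 n^2 (n + M)^2], and half the former separates the
   roots of [x^2 = (n + M) (3 n + M) x - 2 n^2 (n + M)^2] uniformly. *)
Lemma num_growth (alpha beta gamma : C) (M K : R) :
  (1 <= K -> 2200 * (K * K) + 300 <= M ->
  Cmod alpha <= K -> Cmod beta <= K -> Cmod gamma <= K ->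
  forall n,
    0 < Cmod (num (M + alpha) (M + beta) gamma n) /\
    (INR n + M) * (3 * INR n + M) / 2 * Cmod (num (M + alpha) (M + beta) gamma n)
    <= Cmod (num (M + alpha) (M + beta) gamma (S n)))%R.
Proof.
  intros HK HM Ha Hb Hc.
  assert (HKK : (K <= K * K)%R) by nra.
  set (A := num (M + alpha) (M + beta) gamma).
  assert (Hlow : forall n, (2 * ((INR n + M) * (3 * INR n + M) / 2) - 11 * (K * K) * (INR n + M)
    <= Cmod (H_a (M + alpha) (M + beta) n))%R).
  { intros n. pose proof (pos_INR n).
    pose proof (H_a_bound alpha beta M K n ltac:(lra) HK Ha Hb) as Hd.
    set (r := ((INR n + M) * (3 * INR n + M))%R) in *.
    set (a := H_a (M + alpha) (M + beta) n) in *.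
    pose proof (Cmod_triangle a (- (a - RtoC r))) as Ht. rewrite Cmod_opp in Ht.
    replace (a + - (a - RtoC r)) with (RtoC r) in Ht by ring.
    rewrite Cmod_R in Ht. pose proof (Rle_abs r). unfold r in *. lra. }
  induction n as [|n [IH0 IH1]].
  - specialize (Hlow 0%nat). simpl INR in *. unfold A, num. simpl.
    rewrite Cmod_1. split; [lra |].
    assert (11 * (K * K) * (0 + M) <= (0 + M) * (3 * 0 + M) / 2)%R by nra. lra.
  - pose proof (pos_INR n) as Hn.
    set (rho := ((INR n + M) * (3 * INR n + M) / 2)%R) in *.
    assert (Hrho : (0 < rho)%R) by (unfold rho; nra).
    assert (HS : (0 < Cmod (A (S n)))%R) by nra.
    split; [exact HS |].
    specialize (Hlow (S n)).
    pose proof (H_b_bound alpha beta gamma M K (S n) ltac:(lra) Ha Hb Hc) as Hbb.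
    (* [L = 11 K^2] is the error constant of [H_a_bound]; its condition [200 L <= M] explains the
       constant 2200. *)
    pose proof (growth_inequality (INR (S n)) M K (11 * (K * K))
      ltac:(rewrite S_INR; lra) ltac:(lra) ltac:(lra) ltac:(lra) ltac:(lra) ltac:(lra)) as Hg.
    replace (INR (S n) - 1)%R with (INR n) in Hg by (rewrite S_INR; ring).
    fold rho in Hg.
    pose proof (num_rec (M + alpha) (M + beta) gamma n) as Hrec. fold A in Hrec.
    set (a := H_a (M + alpha) (M + beta) (S n)) in *.
    set (b := H_b (M + alpha) (M + beta) gamma (S n)) in *.
    set (r := ((INR (S n) + M) * (3 * INR (S n) + M) / 2)%R) in *.
    set (e := (11 * (K * K) * (INR (S n) + M))%R) in *.
    pose proof (Cmod_triangle (A (S (S n))) (- (b * A n))) as Ht.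
    replace (A (S (S n)) + - (b * A n)) with (a * A (S n)) in Ht by (rewrite Hrec; ring).
    rewrite Cmod_opp, !Cmod_mult in Ht.
    (* The growth inequality bounds [|b|] by [(r - e) rho], and the induction hypothesis bounds
       [rho |A_n|] by [|A_{n+1}|]. Subtracting from [|a| >= 2 r - e] leaves the factor [r]. *)
    assert (Hba : (Cmod b * Cmod (A n) <= (r - e) * Cmod (A (S n)))%R).
    { assert (Hbr : (Cmod b <= (r - e) * rho)%R) by lra.
      assert (Hre : (0 <= r - e)%R).
      { apply Rmult_le_reg_r with (1 := Hrho). pose proof (Cmod_ge_0 b). lra. }
      apply Rle_trans with ((r - e) * rho * Cmod (A n))%R.
      - apply Rmult_le_compat_r; [apply Cmod_ge_0 | exact Hbr].
      - rewrite Rmult_assoc. now apply Rmult_le_compat_l. }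
    assert (Haa : ((2 * r - e) * Cmod (A (S n)) <= Cmod a * Cmod (A (S n)))%R)
      by (apply Rmult_le_compat_r; lra).
    lra.
Qed.

(** The shifts are even so that steps of 2 lead back to the original parameters. *)
Lemma dominant_num_large (alpha beta gamma : C) :
  exists N : nat, dominant (num (alpha + 2 * INR N) (beta + 2 * INR N) gamma).
Proof.
  set (K := (1 + Cmod alpha + Cmod beta + Cmod gamma)%R).
  pose proof (Cmod_ge_0 alpha). pose proof (Cmod_ge_0 beta). pose proof (Cmod_ge_0 gamma).
  destruct (INR_unbounded (2200 * (K * K) + 300)) as [N HN].
  exists N. set (M := (2 * INR N)%R).
  replace (alpha + 2 * INR N) with (M + alpha) by (unfold M; rewrite RtoC_mult; ring).
  replace (beta + 2 * INR N) with (M + beta) by (unfold M; rewrite RtoC_mult; ring).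
  assert (HM : (2200 * (K * K) + 300 <= M)%R).
  { pose proof (pos_INR N). unfold M. lra. }
  assert (HM0 : (0 <= M)%R) by nra.
  pose proof (num_growth alpha beta gamma M K ltac:(unfold K; lra) HM
    ltac:(unfold K; lra) ltac:(unfold K; lra) ltac:(unfold K; lra)) as Hgrow.
  apply dominant_of_growth with (1 := num_rec _ _ _); exists 0%nat; intros n _;
    destruct (Hgrow n) as [Hpos Hle].
  - now apply Cmod_gt_0.
  - eapply Rle_trans; [| exact Hle].
    apply Rmult_le_compat_r; [lra |]. pose proof (pos_INR n). nra.
Qed.

(** * Descent and the contiguous relations *)

Lemma half_shift_neq_0 (z w : C) : ~ nonpos_integer z -> w = 2 * z -> w <> 0.
Proof.
  intros Hz -> He. apply Hz. exists 0%nat. simpl INR.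
  replace z with (2 * z / 2) by field. rewrite He. field.
Qed.

Lemma nonpos_integer_pred (z : C) : nonpos_integer (z + 1) -> nonpos_integer z.
Proof.
  intros [k Hk]. exists (S k). rewrite INR_S.
  replace z with (z + 1 - 1) by ring. rewrite Hk. ring.
Qed.

(** Two of the domain quantities increase by 1, and avoiding nonpositive integers is stable under
    adding 1. So every parameter met in the descent stays in the domain. *)
Lemma H_domain_alpha_add_2 (alpha beta gamma : C) :
  H_domain alpha beta gamma -> H_domain (alpha + 2) beta gamma.
Proof.
  intros (Ha & Hb & Hc & Hd). repeat split; trivial.
  - intros Hn. apply Ha, nonpos_integer_pred.
    replace ((alpha + 1) / 2 + 1) with ((alpha + 2 + 1) / 2) by field.
    exact Hn.
  - intros Hn. apply Hd, nonpos_integer_pred.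
    replace ((alpha + beta + 1) / 2 - gamma + 1)
      with ((alpha + 2 + beta + 1) / 2 - gamma) by field.
    exact Hn.
Qed.

Lemma H_domain_sym (alpha beta gamma : C) :
  H_domain alpha beta gamma -> H_domain beta alpha gamma.
Proof.
  intros (Ha & Hb & Hc & Hd). repeat split; trivial. now rewrite (Cplus_comm beta).
Qed.

Lemma num_sym (alpha beta gamma : C) (n : nat) :
  num alpha beta gamma n = num beta alpha gamma n.
Proof.
  revert n. apply satisfies_rec_unique
    with (H_a alpha beta) (H_b alpha beta gamma); [apply num_rec | | |].
  - intros n. rewrite num_rec. expand_coeffs. ring.
  - reflexivity.
  - expand_coeffs. ring.
Qed.

(** Each factor is twice one of the domain quantities at [alpha - 2]; this is how the domain enters
    the descent. *)
Lemma alpha_shift_const_neq_0 (alpha beta gamma : C) :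
  H_domain (alpha - 2) beta gamma -> (alpha - 1) * (alpha + beta - 2 * gamma - 1) <> 0.
Proof.
  intros (Ha & _ & _ & Hd).
  apply Cmult_neq_0; [apply (half_shift_neq_0 _ _ Ha) | apply (half_shift_neq_0 _ _ Hd)];
    field.
Qed.

Lemma num_alpha_shift_lim (alpha beta gamma : C) :
  dominant (num alpha beta gamma) ->
  Clim (fun n => INR n * INR n * num (alpha - 2) beta gamma n / num alpha beta gamma n)
    ((alpha - 1) * (alpha + beta - 2 * gamma - 1)).
Proof.
  intros Hdom.
  apply (dominant_forcing _ _ _ _ _ Hdom (alpha_coeff_lim alpha gamma)
    (alpha_shift_num alpha beta gamma)).
  apply Clim_ext with (2 := Clim_const _).
  apply filter_imp with (2 := proj1 Hdom). intros n Hn. now field.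
Qed.

Lemma dominant_num_alpha_sub_2 (alpha beta gamma : C) :
  H_domain (alpha - 2) beta gamma ->
  dominant (num alpha beta gamma) -> dominant (num (alpha - 2) beta gamma).
Proof.
  intros Hp Hdom.
  apply (dominant_of_asymp _ _ _ (alpha_shift_const_neq_0 _ _ _ Hp) Hdom).
  now apply num_alpha_shift_lim.
Qed.

Lemma dominant_num_descent (N : nat) (alpha beta gamma : C) :
  H_domain alpha beta gamma ->
  dominant (num (alpha + 2 * INR N) beta gamma) -> dominant (num alpha beta gamma).
Proof.
  revert alpha. induction N as [|N IH]; intros alpha Hp Hdom.
  - simpl INR in Hdom. now replace (alpha + 2 * 0) with alpha in Hdom by ring.
  - pose proof (H_domain_alpha_add_2 _ _ _ Hp) as Hp2.
    replace alpha with (alpha + 2 - 2) by ring.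
    apply dominant_num_alpha_sub_2.
    + now replace (alpha + 2 - 2) with alpha by ring.
    + apply IH; [exact Hp2 |].
      rewrite INR_S in Hdom.
      now replace (alpha + 2 * (INR N + 1)) with (alpha + 2 + 2 * INR N) in Hdom by ring.
Qed.

Lemma H_domain_alpha_add_even (N : nat) (alpha beta gamma : C) :
  H_domain alpha beta gamma -> H_domain (alpha + 2 * INR N) beta gamma.
Proof.
  intros Hp. induction N as [|N IH].
  - simpl INR. now replace (alpha + 2 * 0) with alpha by ring.
  - rewrite INR_S.
    replace (alpha + 2 * (INR N + 1)) with (alpha + 2 * INR N + 2) by ring.
    now apply H_domain_alpha_add_2.
Qed.

(** From a large point, [alpha] is lowered first with [beta] still shifted; then symmetry lets the
    same descent lower [beta]. *)
Lemma dominant_num (alpha beta gamma : C) :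
  H_domain alpha beta gamma -> dominant (num alpha beta gamma).
Proof.
  intros Hp. destruct (dominant_num_large alpha beta gamma) as [N HN].
  apply dominant_ext with (1 := num_sym beta alpha gamma).
  apply (dominant_num_descent N); [now apply H_domain_sym |].
  apply dominant_ext with (1 := num_sym alpha (beta + 2 * INR N) gamma).
  apply (dominant_num_descent N); [| exact HN].
  now apply H_domain_sym, H_domain_alpha_add_even, H_domain_sym.
Qed.

(** * Existence of the limit and the two relations *)

Lemma is_H_H (alpha beta gamma : C) :
  H_domain alpha beta gamma -> is_H alpha beta gamma (H alpha beta gamma).
Proof.
  intros Hp. pose proof (dominant_num _ _ _ Hp) as Hdom.
  destruct (dominant_quotient_cv alpha beta gamma _ _
    (num_rec _ _ _) (den_rec _ _ _) Hdom) as [h Hh].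
  refine (iota_correct (V := C_CompleteNormedModule) (is_H alpha beta gamma) _).
  exists h. split.
  - split; [exact (proj1 Hdom) | now apply Clim_filterlim].
  - intros h' [_ Hh']. apply (Clim_unique _ _ _ Hh). now apply Clim_filterlim.
Qed.

Lemma H_lim (alpha beta gamma : C) :
  H_domain alpha beta gamma ->
  Clim (fun n => den alpha beta gamma n / num alpha beta gamma n) (H alpha beta gamma).
Proof. intros Hp. apply Clim_filterlim, (is_H_H _ _ _ Hp). Qed.

(** The limit of [n^2 B'_n / A_n] is computed twice: by forcing, and as the product of
    [n^2 A'_n / A_n] and [B'_n / A'_n]. *)
Lemma H_alpha_shift (alpha beta gamma : C) :
  H_domain alpha beta gamma -> H_domain (alpha - 2) beta gamma ->
  alpha * (alpha - 2 * gamma - 1) * H alpha beta gamma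
  - (alpha - 1) * (alpha + beta - 2 * gamma - 1) * H (alpha - 2) beta gamma + 1 = 0.
Proof.
  intros Hp Hp2. pose proof (dominant_num _ _ _ Hp) as Hdom.
  pose proof (num_alpha_shift_lim _ _ _ Hdom) as HA.
  assert (HB : Clim (fun n => INR n * INR n * den (alpha - 2) beta gamma n
                              / num alpha beta gamma n)
    (1 + alpha * (alpha - 2 * gamma - 1) * H alpha beta gamma)).
  { apply (dominant_forcing _ _ _ _ _ Hdom (alpha_coeff_lim alpha gamma)
      (alpha_shift_den alpha beta gamma)).
    apply Clim_ext with (fun n => 1 + alpha * (alpha - 2 * gamma - 1)
      * (den alpha beta gamma n / num alpha beta gamma n)).
    - apply filter_imp with (2 := proj1 Hdom). intros n Hn. now field.
    - apply Clim_plus; [apply Clim_const | apply Clim_scal, H_lim, Hp]. }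
  assert (HAB : Clim (fun n => INR n * INR n * den (alpha - 2) beta gamma n
                               / num alpha beta gamma n)
    ((alpha - 1) * (alpha + beta - 2 * gamma - 1) * H (alpha - 2) beta gamma)).
  { eapply Clim_ext; [| exact (Clim_mult _ _ _ _ HA (H_lim _ _ _ Hp2))].
    generalize (filter_and _ _ (proj1 Hdom) (proj1 (dominant_num _ _ _ Hp2))).
    apply filter_imp. intros n [H0 H2]. cbv beta. now field. }
  rewrite <- (Clim_unique _ _ _ HB HAB). ring.
Qed.

(** With [m = n + 1], the term [(d - m) u_m] contributes [-h], while [c_m u_{m-1}] contributes
    [h / 2] because [A_m] grows like [2 m^2 A_{m-1}]. *)
Lemma gamma_shift_lim (alpha beta gamma : C) (u : nat -> C) (h : C) :
  dominant (num alpha beta gamma) ->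
  Clim (fun n => u n / num alpha beta gamma n) h ->
  Clim (fun n => gamma_shift alpha beta gamma u n
                 / (INR (S n) * num alpha beta gamma (S n))) (- h / 2).
Proof.
  intros [H0 Hz] Hu.
  set (A := num alpha beta gamma) in *.
  apply (eq_ind (-1 * 1 * h + 1 * 1 * (h / 2)) (Clim _)); [| field].
  apply Clim_ext with (fun n =>
    -1 * ((INR (S n) + (alpha + beta + 1 - 2 * gamma)) / INR (S n)) * (u (S n) / A (S n))
    + ((INR n + (1 + alpha)) / INR n) * ((INR n + (1 + beta)) / INR n)
      * ((u n / A n) / (A (S n) / (INR n * INR n * A n)))).
  - generalize (filter_and _ _ eventually_INR_neq_0 (filter_and _ _ H0 (eventually_S _ H0))).
    apply filter_imp. intros n (Hn & HA & HAS).
    pose proof (INR_neq_0 (S n) ltac:(lia)) as HS. rewrite INR_S in HS.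
    unfold gamma_shift. expand_coeffs. field. repeat split; assumption.
  - apply Clim_plus.
    + apply Clim_mult; [apply Clim_mult; [apply Clim_const |] |].
      * apply (Clim_succ (fun n => (INR n + (alpha + beta + 1 - 2 * gamma)) / INR n)),
          Clim_INR_plus_div.
      * apply (Clim_succ (fun n => u n / A n)), Hu.
    + apply Clim_mult; [apply Clim_mult; apply Clim_INR_plus_div |].
      apply Clim_div; [apply C2_neq_0 | exact Hu | exact Hz].
Qed.

Lemma H_gamma_shift (alpha beta gamma : C) :
  H_domain alpha beta gamma -> H_domain alpha beta (gamma - 1) ->
  2 * gamma * (2 * gamma - alpha - beta - 1) * H alpha beta gamma
  - (2 * gamma - alpha - 1) * (2 * gamma - beta - 1) * H alpha beta (gamma - 1) + 1 = 0.
Proof.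
  intros Hp Hp1.
  pose proof (dominant_num _ _ _ Hp) as Hdom. pose proof (dominant_num _ _ _ Hp1) as Hdom1.
  set (h := H alpha beta gamma). set (h1 := H alpha beta (gamma - 1)).
  set (delta := 2 * gamma - alpha - beta - 1).
  set (mu := (2 * gamma - alpha - 1) * (2 * gamma - beta - 1)).
  assert (HA : Clim (fun n => num alpha beta gamma n / num alpha beta gamma n) 1).
  { apply Clim_ext with (2 := Clim_const _).
    apply filter_imp with (2 := proj1 Hdom). intros n Hn. now field. }
  apply (gamma_shift_lim alpha beta gamma _ _ Hdom) in HA.
  pose proof (gamma_shift_lim alpha beta gamma _ _ Hdom (H_lim _ _ _ Hp)) as HB.
  pose proof (proj1 (Clim_succ _ _) (H_lim _ _ _ Hp1)) as Hq.
  (* Two values of one limit. Multiplying the denominator identity by [delta] turns [delta A'] into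
     the shifted numerators, whose quotient tends to [-1/2] by [HA]. *)
  assert (HAB : mu * h1 * (- (1) / 2) - - (1) / 2 = 2 * gamma * delta * (- h / 2)).
  { apply (Clim_unique (fun n => 2 * gamma * delta
      * (gamma_shift alpha beta gamma (den alpha beta gamma) n
         / (INR (S n) * num alpha beta gamma (S n))))).
    - eapply Clim_ext; [| exact (Clim_minus _ _ _ _
        (Clim_mult _ _ _ _ (Clim_scal mu _ _ Hq) HA) HA)].
      generalize (filter_and _ _ (eventually_S _ (proj1 Hdom)) (eventually_S _ (proj1 Hdom1))).
      apply filter_imp. intros n [H0 H1]. cbv beta.
      pose proof (INR_neq_0 (S n) ltac:(lia)) as HS.
      pose proof (gamma_shift_den alpha beta gamma n) as Hden. fold mu in Hden.
      rewrite gamma_shift_num. fold delta.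
      transitivity (delta * (2 * gamma * gamma_shift alpha beta gamma (den alpha beta gamma) n)
        / (INR (S n) * num alpha beta gamma (S n))); [rewrite Hden |]; field;
        repeat split; assumption.
    - apply Clim_scal, HB. }
  replace (2 * gamma * delta * h - mu * h1 + 1)
    with (-2 * (2 * gamma * delta * (- h / 2)) - mu * h1 + 1) by field.
  rewrite <- HAB. field.
Qed.

Theorem theorem2p2 :
  forall alpha beta gamma : C,
  H_domain alpha beta gamma ->
  is_H alpha beta gamma (H alpha beta gamma) /\
  (H_domain (alpha - 2) beta gamma ->
     alpha * (alpha - 2 * gamma - 1) * H alpha beta gamma
     - (alpha - 1) * (alpha + beta - 2 * gamma - 1) * H (alpha - 2) beta gamma
     + 1 = 0) /\
  (H_domain alpha beta (gamma - 1) ->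
     2 * gamma * (2 * gamma - alpha - beta - 1) * H alpha beta gamma
     - (2 * gamma - alpha - 1) * (2 * gamma - beta - 1) * H alpha beta (gamma - 1)
     + 1 = 0).
Proof.
  intros alpha beta gamma Hp.
  split; [| split].
  - now apply is_H_H.
  - now apply H_alpha_shift.
  - now apply H_gamma_shift.
Qed.
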